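(* Let $L,M$ be metric spaces and let $(f_i:L\to M)_{i\in\mathbb N}$ be a sequence of uniformly continuous functions. The following are equivalent: (i) the sequence $(f_i)$ is uniformly equicontinuous; (ii) the maps $\mathbb N\times L^n\to M^n$, $(i,x_1,\dots,x_n)\mapsto(f_i(x_1),\dots,f_i(x_n))$ $(n\ge 1)$, form a morphism $(\mathbb N_{cof})_{const}\times L_{u}\to M_{u}$ in $\mathrm{sFilt}$; (iii) the maps $\mathbb N^n\times L^n\to M^n$, $(i_1,\dots,i_n,x_1,\dots,x_n)\mapsto(f_{i_1}(x_1),\dots,f_{i_n}(x_n))$ $(n\ge 1)$, form a morphism $(\mathbb N_{cof})_{diag}\times L_{u}\to M_{u}$ in $\mathrm{sFilt}$.
   Context: A filter on a set $X$ is a collection of subsets of $X$, called neighbourhoods, closed under finite intersections (in particular containing $X$) and under passing to supersets; $\emptyset$ is allowed to be a neighbourhood and $X$ is allowed to be empty. A morphism of filters (a continuous map) is a function of the underlying sets such that the preimage of every neighbourhood is a neighbourhood. $\mathrm{Filt}$ is the category of filters. $\Delta$ is the category of finite linear orders $n_\le=\{0<\dots<n-1\}$, $n\ge 1$, and non-decreasing maps, and $\mathrm{sFilt}=\mathrm{Fun}(\Delta^{op},\mathrm{Filt})$ is the category of simplicial filters; a morphism in $\mathrm{sFilt}$ is a map of the underlying simplicial sets which is continuous at every level. Products in $\mathrm{sFilt}$ are levelwise products of filters (a neighbourhood in the product is a set containing a product of neighbourhoods). For a metric space $M$, $M_{u}\in\mathrm{sFilt}$ has underlying simplicial set $n_\le\mapsto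 \mathrm{Hom}_{\mathrm{Sets}}(n,M)=M^n$, and $\varepsilon\subset M^n$ is a neighbourhood iff there is $\epsilon>0$ such that $(x_1,\dots,x_n)\in\varepsilon$ whenever $\mathrm{dist}(x_i,x_j)<\epsilon$ for all $i,j$. $\mathbb N_{cof}$ is $\mathbb N$ with the filter of cofinite subsets. $(\mathbb N_{cof})_{const}$ is the constant functor $n_\le\mapsto\mathbb N_{cof}$. $(\mathbb N_{cof})_{diag}$ has underlying simplicial set $n_\le\mapsto\mathbb N^n$, where a subset of $\mathbb N^n$ is a neighbourhood iff it contains $\{(i,i,\dots,i): i>N\}$ for some $N>0$. Uniform equicontinuity of $(f_i)$ means: for every $\epsilon>0$ there is $\delta>0$ such that $\mathrm{dist}(f_i(x),f_i(y))<\epsilon$ for all $i\in\mathbb N$ and all $x,y\in L$ with $\mathrm{dist}(x,y)<\delta$. *)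

(* Defs.v *)
From mathcomp Require Import all_boot all_order all_algebra.
From mathcomp Require Import boolp classical_sets cardinality filter reals topology.

Set Implicit Arguments.
Unset Strict Implicit.
Unset Printing Implicit Defensive.

Import Order.TTheory GRing.Theory Num.Theory.

Local Open Scope classical_set_scope.
Local Open Scope ring_scope.

(** * The category of filters *)

(* [Filter], as opposed to [ProperFilter], allows [set0] to be a
   neighbourhood; the carrier is an arbitrary, possibly empty, type. *)
Record filt := Filt {
  carrier :> Type;
  neigh : set_system carrier;
  neighF : Filter neigh }.

Definition filt_continuous (X Y : filt) (f : X -> Y) : Prop :=
  forall V : set Y, neigh V -> neigh (f @^-1` V).

(* [filter_prod F G] consists of the sets containing some [A `*` B] with
   [F A] and [G B]. *)
Definition filt_prod (X Y : filt) : filt :=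
  @Filt (X * Y)%type (filter_prod (@neigh X) (@neigh Y))
    (filter_prod_filter (neighF X) (neighF Y)).

(** * The simplex category *)

(* The objects are the linear orders [n_<=], [n >= 1]; the object [n_<=] is
   encoded by the predecessor [k] of [n = k.+1], with underlying set
   ['I_k.+1]. *)
Record delta_hom (k l : nat) := DeltaHom {
  delta_fun :> 'I_k.+1 -> 'I_l.+1;
  delta_homo : {homo delta_fun : i j / (i <= j)%N} }.

Definition delta_id (k : nat) : delta_hom k k :=
  @DeltaHom k k id (fun _ _ => id).

Definition delta_comp (k l m : nat) (t : delta_hom l m) (s : delta_hom k l) :
    delta_hom k m :=
  @DeltaHom k m (t \o s) (fun i j ij => delta_homo t (delta_homo s ij)).

(** * Simplicial filters: functors from the opposite of the simplex category
    to filters *)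

Record sfilt := SFilt {
  level :> nat -> filt;
  pull : forall k l : nat, delta_hom k l -> level l -> level k;
  pull_continuous : forall (k l : nat) (s : delta_hom k l),
    filt_continuous (pull s);
  pull_id : forall (k : nat) (x : level k), pull (delta_id k) x = x;
  pull_comp : forall (k l m : nat) (t : delta_hom l m) (s : delta_hom k l)
    (x : level m), pull (delta_comp t s) x = pull s (pull t x) }.

Definition is_sfilt_morphism (X Y : sfilt) (f : forall k : nat, X k -> Y k) :
    Prop :=
  (forall (k l : nat) (s : delta_hom k l) (x : X l),
     f k (pull s x) = pull s (f l x)) /\
  (forall k : nat, filt_continuous (f k)).
Arguments is_sfilt_morphism : clear implicits.

Section product.
Variables X Y : sfilt.

Definition sfilt_prod_pull (k l : nat) (s : delta_hom k l)
    (p : filt_prod (X l) (Y l)) : filt_prod (X k) (Y k) :=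
  (pull s p.1, pull s p.2).

Fact sfilt_prod_pull_continuous (k l : nat) (s : delta_hom k l) :
  filt_continuous (sfilt_prod_pull s).
Proof.
move=> V [[A B] /= [XA YB] ABV].
exists (pull s @^-1` A, pull s @^-1` B) => /=.
  by split; exact: pull_continuous.
by move=> [x y] /= [Ax By]; apply: ABV.
Qed.

Fact sfilt_prod_pull_id (k : nat) (p : filt_prod (X k) (Y k)) :
  sfilt_prod_pull (delta_id k) p = p.
Proof. by case: p => x y; rewrite /sfilt_prod_pull !pull_id. Qed.

Fact sfilt_prod_pull_comp (k l m : nat) (t : delta_hom l m)
    (s : delta_hom k l) (p : filt_prod (X m) (Y m)) :
  sfilt_prod_pull (delta_comp t s) p = sfilt_prod_pull s (sfilt_prod_pull t p).
Proof. by rewrite /sfilt_prod_pull !pull_comp. Qed.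

Definition sfilt_prod : sfilt :=
  @SFilt (fun k => filt_prod (X k) (Y k)) sfilt_prod_pull
    sfilt_prod_pull_continuous sfilt_prod_pull_id sfilt_prod_pull_comp.

End product.

(** * Constant simplicial filters *)

Definition sfilt_const (X : filt) : sfilt :=
  @SFilt (fun=> X) (fun _ _ _ => id) (fun _ _ _ _ => id)
    (fun _ _ => erefl) (fun _ _ _ _ _ _ => erefl).

Fact cofinite_filter (T : Type) : Filter [set A : set T | cofinite_set A].
Proof.
split=> [|A B|A B AB] /=; first exact: cofinite_setT.
- by rewrite setCI finite_setU.
- exact: sub_cofinite_set.
Qed.

Definition nat_cof : filt := @Filt nat _ (cofinite_filter nat).

(** * The diagonal simplicial filter on the natural numbers *)

Definition diag_neigh (k : nat) : set_system ('I_k.+1 -> nat) :=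
  [set A | exists2 N : nat, (0 < N)%N &
     [set (fun=> i) | i in [set i : nat | (N < i)%N]] `<=` A].

Fact diag_filter (k : nat) : Filter (@diag_neigh k).
Proof.
split=> [|A B [N N0 NA] [P P0 PB]|A B AB [N N0 NA]].
- by exists 1%N.
- exists (maxn N P); first by rewrite leq_max N0.
  move=> _ [i /= + <-]; rewrite gtn_max => /andP[Ni Pi].
  by split; [apply: NA; exists i | apply: PB; exists i].
- by exists N => //; exact: subset_trans AB.
Qed.

Definition diag_level (k : nat) : filt := Filt (diag_filter k).

Definition diag_pull (k l : nat) (s : delta_hom k l) (x : diag_level l) :
  diag_level k := x \o s.

Fact diag_pull_continuous (k l : nat) (s : delta_hom k l) :
  filt_continuous (diag_pull s).
Proof.
move=> V [N N0 NV]; exists N => // _ [i Ni <-].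
by apply: NV; exists i.
Qed.

Definition nat_cof_diag : sfilt :=
  @SFilt diag_level diag_pull diag_pull_continuous
    (fun _ _ => erefl) (fun _ _ _ _ _ _ => erefl).

(** * The simplicial filter of a metric space *)

Section unif.
Variables (R : realType) (M : metricType R).

Definition unif_neigh (k : nat) : set_system ('I_k.+1 -> M) :=
  [set E | exists2 e : R, 0 < e &
     forall x : 'I_k.+1 -> M,
       (forall i j : 'I_k.+1, mdist (x i) (x j) < e) -> E x].

Fact unif_filter (k : nat) : Filter (@unif_neigh k).
Proof.
split=> [|A B [d d0 dA] [e e0 eB]|A B AB [e e0 eA]].
- by exists 1.
- exists (Num.min d e); first by rewrite lt_min d0.
  move=> x xde; split.
  + by apply: dA => i j; have := xde i j; rewrite lt_min => /andP[].
  + by apply: eB => i j; have := xde i j; rewrite lt_min => /andP[].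
- by exists e => // x xe; exact/AB/eA.
Qed.

Definition unif_level (k : nat) : filt := Filt (unif_filter k).

Definition unif_pull (k l : nat) (s : delta_hom k l) (x : unif_level l) :
  unif_level k := x \o s.

Fact unif_pull_continuous (k l : nat) (s : delta_hom k l) :
  filt_continuous (unif_pull s).
Proof.
move=> V [e e0 eV]; exists e => // x xe.
by apply: eV => i j; exact: xe.
Qed.

Definition sfilt_unif : sfilt :=
  @SFilt unif_level unif_pull unif_pull_continuous
    (fun _ _ => erefl) (fun _ _ _ _ _ _ => erefl).

End unif.

(** * Sequences of functions between metric spaces *)

Section sequence.
Variables (R : realType) (L M : metricType R) (f : nat -> L -> M).

Definition uniformly_equicontinuous : Prop :=
  forall e : R, 0 < e -> exists2 d : R, 0 < d &
    forall (i : nat) (x y : L),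
      mdist x y < d -> mdist (f i x) (f i y) < e.

Definition eval_const (k : nat)
    (p : sfilt_prod (sfilt_const nat_cof) (sfilt_unif L) k) : sfilt_unif M k :=
  fun j : 'I_k.+1 => f p.1 (p.2 j).

Definition eval_diag (k : nat)
    (p : sfilt_prod nat_cof_diag (sfilt_unif L) k) : sfilt_unif M k :=
  fun j : 'I_k.+1 => f (p.1 j) (p.2 j).

End sequence.

(* Main.v *)
Require Import Defs.
From mathcomp Require Import all_boot all_order all_algebra.
From mathcomp Require Import boolp classical_sets cardinality filter reals topology.

(** Continuity at level [n = 2] only sees a tail of the sequence: a neighbourhood
    of either simplicial filter on the naturals contains the diagonal points
    [(i, i)] with [i] large, so each of (ii) and (iii) gives a common modulus of
    continuity for all [f_i] with [i > N].  The finitely many remaining functions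
    are uniformly continuous, whence equicontinuity.  Conversely a common modulus
    of continuity works at every level; for (iii) the diagonal itself is a
    neighbourhood, so distinct indices never have to be compared. *)

Set Implicit Arguments.
Unset Strict Implicit.
Unset Printing Implicit Defensive.

Import Order.TTheory GRing.Theory Num.Theory.

Local Open Scope classical_set_scope.
Local Open Scope ring_scope.

(** The finite complement is listed by a sequence, and its maximum serves as [N]. *)
Lemma cofinite_nat_tail (A : set nat) :
  cofinite_set A -> exists N : nat, forall i, (N < i)%N -> A i.
Proof.
move=> /finite_seqP[s sE]; exists (\max_(n <- s) n) => i Ni.
apply: contrapT => nAi; have : (~` A) i by [].
rewrite sE /= => si.
by move: Ni; rewrite ltnNge (leq_bigmax_seq (F := id)).
Qed.

Section metric.
Variables (R : realType) (L M : metricType R).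

(** Entourages of a metric space are generated by balls, which turns the library notion into its
    epsilon-delta form. *)
Lemma unif_continuous_mdist (g : L -> M) : unif_continuous g ->
  forall e : R, 0 < e -> exists2 d : R, 0 < d &
    forall x y : L, mdist x y < d -> mdist (g x) (g y) < e.
Proof.
move=> gu e e0.
have /gu : entourage [set xy : M * M | mdist xy.1 xy.2 < e].
  rewrite -entourage_ballE; exists e => //= -[x y] /=.
  by rewrite ballEmdist.
rewrite /nbhs /= -entourage_ballE => -[d /= d0 dg]; exists d => // x y xy.
by apply: (dg (x, y)); rewrite /= ballEmdist.
Qed.

Definition two_points (x y : L) : 'I_2 -> L :=
  fun j => if j == ord0 then x else y.

Lemma two_points_mdist (x y : L) (d : R) : 0 < d -> mdist x y < d ->
  forall i j, mdist (two_points x y i) (two_points x y j) < d.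
Proof.
move=> d0 xyd i j; rewrite /two_points.
(* Equal points are at distance zero, so [d0] settles these cases; the mixed cases are [xyd] up to
   symmetry. *)
by case: ifP; case: ifP => _ _; rewrite ?mdistxx // metric_sym.
Qed.

Variable f : nat -> L -> M.
Hypothesis f_unif : forall i : nat, unif_continuous (f i).

(** Induction on [N], taking the minimum of finitely many moduli; uniform continuity of each single
    [f i] enters here. *)
Lemma head_equicontinuous (N : nat) (e : R) : 0 < e ->
  exists2 d : R, 0 < d & forall (i : nat) (x y : L), (i <= N)%N ->
    mdist x y < d -> mdist (f i x) (f i y) < e.
Proof.
move=> e0; elim: N => [|N [d d0 fd]].
  have [d d0 fd] := unif_continuous_mdist (f_unif 0%N) e0.
  by exists d => // i x y; rewrite leqn0 => /eqP ->; exact: fd.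
have [d' d'0 fd'] := unif_continuous_mdist (f_unif N.+1) e0.
exists (Num.min d d'); first by rewrite lt_min d0.
move=> i x y; rewrite leq_eqVlt lt_min => /predU1P[->|iN] /andP[xd xd'].
  exact: fd'.
exact: fd.
Qed.

Lemma tail_equicontinuous :
  (forall e : R, 0 < e -> exists (N : nat) (d : R), 0 < d /\
    forall (i : nat) (x y : L), (N < i)%N ->
      mdist x y < d -> mdist (f i x) (f i y) < e) ->
  uniformly_equicontinuous f.
Proof.
move=> ft e e0; have [N [d [d0 fd]]] := ft _ e0.
have [d' d'0 fd'] := head_equicontinuous N e0.
exists (Num.min d d'); first by rewrite lt_min d0.
move=> i x y; rewrite lt_min => /andP[xd xd'].
by have [iN|Ni] := leqP i N; [exact: fd' | exact: fd].
Qed.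

Lemma equicontinuous_const :
  uniformly_equicontinuous f <->
  is_sfilt_morphism (sfilt_prod (sfilt_const nat_cof) (sfilt_unif L))
    (sfilt_unif M) (eval_const f).
Proof.
split=> [fe|[_ fc]].
  split=> // k V [e e0 eV]; have [d d0 fd] := fe _ e0.
  exists (setT, [set x | forall i j, mdist (x i) (x j) < d]) => /=.
    by split; [exact: cofinite_setT | exists d].
  by move=> [i x] [_ /= xd]; apply: eV => j l; exact: fd.
apply: tail_equicontinuous => e e0.
(* Index [1] encodes the level of pairs, since objects are indexed by [n - 1]. *)
have /(fc 1%N)[[A B] /= [/cofinite_nat_tail[N NA] [d d0 dB]] ABV] :
    unif_neigh [set z : 'I_2 -> M | mdist (z ord0) (z ord_max) < e].
  by exists e => // z; exact.
exists N, d; split=> // i x y Ni xyd.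
apply: (ABV (i, two_points x y)).
by split; [exact: NA | exact/dB/two_points_mdist].
Qed.

Lemma equicontinuous_diag :
  uniformly_equicontinuous f <->
  is_sfilt_morphism (sfilt_prod nat_cof_diag (sfilt_unif L))
    (sfilt_unif M) (eval_diag f).
Proof.
split=> [fe|[_ fc]].
  split=> // k V [e e0 eV]; have [d d0 fd] := fe _ e0.
  (* The whole diagonal: on it all coordinates share one index [i], so the modulus of the single
     function [f i] applies. *)
  exists (range (fun i (_ : 'I_k.+1) => i),
          [set x | forall i j, mdist (x i) (x j) < d]) => /=.
    by split; [exists 1%N => // _ [i _ <-]; exists i | exists d].
  by move=> [_ x] [/= [i _ <-] xd]; apply: eV => j l; exact: fd.
apply: tail_equicontinuous => e e0.
have /(fc 1%N)[[A B] /= [[N _ NA] [d d0 dB]] ABV] :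
    unif_neigh [set z : 'I_2 -> M | mdist (z ord0) (z ord_max) < e].
  by exists e => // z; exact.
exists N, d; split=> // i x y Ni xyd.
apply: (ABV (fun=> i, two_points x y)).
by split; [apply: NA; exists i | exact/dB/two_points_mdist].
Qed.

End metric.

Theorem mainTheorem3 (R : realType) (L M : metricType R) (f : nat -> L -> M)
    (f_unif : forall i : nat, unif_continuous (f i)) :
  (uniformly_equicontinuous f <->
     is_sfilt_morphism
       (sfilt_prod (sfilt_const nat_cof) (sfilt_unif L)) (sfilt_unif M)
       (eval_const f)) /\
  (uniformly_equicontinuous f <->
     is_sfilt_morphism
       (sfilt_prod nat_cof_diag (sfilt_unif L)) (sfilt_unif M)
       (eval_diag f)).
Proof.
by split; [exact: equicontinuous_const | exact: equicontinuous_diag].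
Qed.
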